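(* Let $X$ be a separable metric space which is Borel and countable dense homogeneous (CDH). Then $X$ is completely metrizable.
   Context: A separable topological space $X$ is countable dense homogeneous (CDH) if for any two countable dense subsets $D, D' \subseteq X$ there is a homeomorphism $h : X \to X$ such that $h[D]=D'$. A separable metric space is called Borel if it is a Borel subset of its completion. *)

(* Defs.v *)
From HB Require Import structures.
From mathcomp Require Import all_boot all_order all_algebra.
From mathcomp Require Import all_classical all_reals all_analysis.

Set Implicit Arguments.
Unset Strict Implicit.
Unset Printing Implicit Defensive.

Import Order.TTheory GRing.Theory Num.Theory.
Import numFieldNormedType.Exports.

Local Open Scope classical_set_scope.
Local Open Scope ring_scope.

Definition separable_space (T : topologicalType) : Prop :=
  exists2 D : set T, countable D & dense D.

Definition homeomorphism (T U : topologicalType) (h : T -> U) : Prop :=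
  exists g : U -> T,
    [/\ cancel h g, cancel g h, continuous h & continuous g].

(* As in the library, [countable] includes the finite sets. *)
Definition countable_dense_homogeneous (T : topologicalType) : Prop :=
  separable_space T /\
  forall D D' : set T, countable D -> dense D -> countable D' -> dense D' ->
    exists h : T -> T, homeomorphism h /\ h @` D = D'.

Definition is_distance (R : realType) (T : Type) (d : T -> T -> R) : Prop :=
  [/\ forall x y, 0 <= d x y,
      forall x y, d x y = 0 <-> x = y,
      forall x y, d x y = d y x
    & forall x y z, d x z <= d x y + d y z].

(* The library's [completeType] is pointed, which would exclude the empty
   space; completeness is therefore stated for a distance function. *)
Definition complete_distance (R : realType) (T : Type) (d : T -> T -> R) :
    Prop :=
  forall u : nat -> T,
    (forall e : R, 0 < e -> exists N : nat, forall m n : nat,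
        (N <= m)%N -> (N <= n)%N -> d (u m) (u n) < e) ->
    exists l : T, forall e : R, 0 < e -> exists N : nat, forall n : nat,
        (N <= n)%N -> d (u n) l < e.

Definition distance_induces_topology (R : realType) (T : topologicalType)
    (d : T -> T -> R) : Prop :=
  forall (x : T) (A : set T),
    nbhs x A <-> exists2 e : R, 0 < e & [set y | d x y < e] `<=` A.

Definition completely_metrizable (R : realType) (T : topologicalType) : Prop :=
  exists d : T -> T -> R,
    [/\ is_distance d, distance_induces_topology d & complete_distance d].

Definition is_completion (R : realType) (X Y : metricType R) (i : X -> Y) :
    Prop :=
  [/\ complete_distance (@mdist R Y),
      forall x y, mdist (i x) (i y) = mdist x y
    & dense (range i)].

Definition borel_set (T : topologicalType) (A : set T) : Prop :=
  <<s [set U : set T | open U] >> A.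

(* Completions are unique up to an isometry fixing X, so it does not matter
   which completion is used. *)
Definition borel_space (R : realType) (X : metricType R) : Prop :=
  exists (Y : metricType R) (i : X -> Y),
    is_completion i /\ borel_set (range i).

(* Main.v *)
Require Import Defs.
From mathcomp Require Import all_boot all_order all_algebra.
From mathcomp Require Import all_classical all_reals all_analysis.
From mathcomp Require Import lra zify.

(** Let [Y] be the completion of [X], let [i] be the embedding and [A] its
    range, a Borel set.  Two facts about Borel sets are used: they have the
    Baire property ([borel_baire_property]), and they are analytic, that is,
    projections of closed subsets of the product of [Y] with the sequences of
    integers ([borel_analytic]).

    Everything rests on a category argument for analytic sets
    ([analytic_notin_sigma_ideal]): if an analytic set lies outside a
    sigma-ideal, it has countably many subsets [E k], each outside the ideal,
    such that every countable closed cover of the set has a member containing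
    some [E k].  This is applied twice.

    By the Baire property, [A] agrees with an open set [O] up to closed nowhere
    dense sets [F n].  The set [G] of points of [O] outside all [F n] is a
    G-delta set contained in [A] and dense in [O], and the part [U] of [X]
    outside the closure of [O] is the largest meager open subset of [X]; hence
    every autohomeomorphism of [X] preserves [U].

    First, [U] is empty.  By Fitzpatrick and Zhou's observation
    ([thin_countable_dense]), [U] has a countable dense subset meeting every
    [F n] in a finite set.  If [U] were uncountable, the [E k] for the ideal of
    countable sets would be infinite, and a countable dense set containing
    infinitely many points of each [E k] would meet some member of each
    countable closed cover of [U] in an infinite set; homogeneity cannot
    exchange the two.  If [U] were countable, it could be exchanged with [U]
    minus a point, although it is preserved by homeomorphisms.

    So [G] is dense in [Y], and [X] has a countable dense subset [D2] inside the
    G-delta set [G].  By homogeneity every countable subset of [X], once united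
    with [D2], is the image of [D2] under a homeomorphism of [X]; by
    Lavrentiev's argument ([gdelta_homeo_image]) it is contained in a G-delta
    subset of [Y] contained in [A].  If [A] were not itself a G-delta set, its
    complement, which is analytic, would lie outside the ideal generated by the
    closed sets disjoint from [A].  The closure of each [E k] would then meet
    [A], and the points of [A] so obtained would form a countable subset of [A]
    contained in no G-delta subset of [A] ([countable_not_in_gdelta]).  Hence
    [A] is a G-delta set, and Alexandroff's theorem
    ([gdelta_completely_metrizable]) yields the complete metric on [X]. *)

Set Implicit Arguments.
Unset Strict Implicit.
Unset Printing Implicit Defensive.

Import Order.TTheory GRing.Theory Num.Theory.
Import numFieldNormedType.Exports.

Local Open Scope classical_set_scope.
Local Open Scope ring_scope.

(** * Metric preliminaries *)

Definition countable_base (T : topologicalType) (B : nat -> set T) :=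
  forall x U, nbhs x U -> exists2 m, B m x & B m `<=` U.

Section MetricPreliminaries.
Context {R : realType} {Y : metricType R}.
Implicit Types (x y : Y) (A : set Y).

Lemma nbhs_mdistP x A :
  nbhs x A <-> exists2 e : R, 0 < e & forall y, mdist x y < e -> A y.
Proof.
split.
  move=> /nbhs_ballP[e /= e0 eA]; exists e => // y xy.
  by apply: eA; rewrite ballEmdist.
move=> [e e0 eA]; apply/nbhs_ballP; exists e => //= y.
by rewrite ballEmdist; exact: eA.
Qed.

Lemma open_mdist_lt x (e : R) : open [set y | mdist x y < e].
Proof.
rewrite openE => y /= xy; apply/nbhs_mdistP.
exists (e - mdist x y); first by rewrite subr_gt0.
move=> z yz /=; have := metric_triangle x y z; lra.
Qed.

Lemma closed_mdist_le x (e : R) : closed [set y | mdist x y <= e].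
Proof.
rewrite -openC openE => y /= xy.
have {}xy : e < mdist x y by rewrite ltNge; apply/negP.
apply/nbhs_mdistP; exists (mdist x y - e); first by rewrite subr_gt0.
move=> z yz /= xz; have := metric_triangle x z y.
rewrite (metric_sym z y); lra.
Qed.

Lemma invS_lt (e : R) : 0 < e -> exists n, n.+1%:R^-1 < e.
Proof.
move=> e0; have [n _ /(_ n (leqnn n))] := near_infty_natSinv_lt (PosNum e0).
by exists n.
Qed.

Lemma invS_le m n : (m <= n)%N -> n.+1%:R^-1 <= m.+1%:R^-1 :> R.
Proof. by move=> mn; rewrite lef_pV2 ?posrE// ler_nat ltnS. Qed.

(** The form in which completeness is used: points that stay in balls
    [B(w n, r n)] of radii tending to [0] converge to a point common to the
    closed balls. *)
Lemma complete_shrinking_balls (w x : nat -> Y) (r : nat -> R) :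
  complete_distance (@mdist R Y) ->
  (forall n, r n <= n.+1%:R^-1) ->
  (forall n m, (n <= m)%N -> mdist (w n) (x m) <= r n) ->
  exists l, (forall e, 0 < e ->
      exists N, forall n, (N <= n)%N -> mdist (x n) l < e) /\
    forall n, mdist (w n) l <= r n.
Proof.
move=> Yc r0 wx; have [e e0|l xl] := Yc x.
  have [n ne] := invS_lt (divr_gt0 e0 (ltr0n R 2)).
  exists n => i j ni nj; have := metric_triangle (x i) (w n) (x j).
  have := r0 n; have := wx _ _ ni; have := wx _ _ nj.
  rewrite (metric_sym (x i) (w n)); move: ne; set u := _^-1; lra.
exists l; split => // n; apply/ler_addgt0Pr => e e0.
have [N Nl] := xl _ e0; have := metric_triangle (w n) (x (maxn n N)) l.
have := wx n _ (leq_maxl n N); have := Nl _ (leq_maxr n N); lra.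
Qed.

Lemma separable_countable_base (D : set Y) : countable D -> dense D ->
  exists2 B : nat -> set Y, forall m, open (B m) & countable_base B.
Proof.
move=> /countable_injP[f finj] Dd.
pose B m := if unpickle m is Some (j, n) then
  \bigcup_(x in [set x | D x /\ f x = j]) [set y | mdist x y < n.+1%:R^-1]
  else set0.
exists B => [m|x U /nbhs_mdistP[e e0 xU]].
  rewrite /B; case: (unpickle m) => [[j n]|]; last exact: open0.
  by apply: bigcup_open => x _; exact: open_mdist_lt.
have [n ne] := invS_lt (divr_gt0 e0 (ltr0n R 2)).
have [|y /= [xy Dy]] := Dd _ _ (open_mdist_lt x n.+1%:R^-1).
  by exists x; rewrite /= mdistxx.
exists (pickle (f y, n)); rewrite /B pickleK.
  by exists y => //=; rewrite metric_sym.
move=> z [y' [Dy' /finj yy'] /=]; rewrite yy' ?inE// => yz.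
apply: xU; have := metric_triangle x y z.
move: xy ne yz => /=; set u := _^-1; lra.
Qed.

End MetricPreliminaries.

(** * Ideals generated by closed sets, and meager sets *)

(** The sigma-ideal generated by the sets satisfying [P]. *)
Definition sigma_ideal_of T (P : set T -> Prop) (A : set T) :=
  exists2 F : nat -> set T, forall n, P (F n) & A `<=` \bigcup_n F n.

Lemma sigma_ideal_ofS T (P : set T -> Prop) (A B : set T) :
  A `<=` B -> sigma_ideal_of P B -> sigma_ideal_of P A.
Proof. by move=> AB [F PF BF]; exists F => // x /AB/BF. Qed.

Lemma sigma_ideal_of_bigcup T (P : set T -> Prop) (A : nat -> set T) :
  P set0 -> (forall n, sigma_ideal_of P (A n)) ->
  sigma_ideal_of P (\bigcup_n A n).
Proof.
move=> P0 PA; have /choice[F PF] : forall n, exists F : nat -> set T,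
    (forall k, P (F k)) /\ A n `<=` \bigcup_k F k.
  by move=> n; case: (PA n) => F; exists F.
exists (fun k => if unpickle k is Some (m, n) then F m n else set0).
  by move=> k; case: (unpickle k) => [[m n]|//]; case: (PF m).
move=> x [m _ Ax]; have [_ /(_ _ Ax)[n _ Fx]] := PF m.
by exists (pickle (m, n)) => //; rewrite pickleK.
Qed.

Lemma sigma_ideal_of_gen T (P : set T -> Prop) (A : set T) :
  P A -> sigma_ideal_of P A.
Proof. by exists (fun=> A) => // x; exists 0%N. Qed.

Lemma sigma_ideal_ofU T (P : set T -> Prop) (A B : set T) :
  P set0 -> sigma_ideal_of P A -> sigma_ideal_of P B ->
  sigma_ideal_of P (A `|` B).
Proof.
move=> P0 PA PB; rewrite -bigcup2E; apply: sigma_ideal_of_bigcup => //.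
by move=> [|[|n]] //=; exact: sigma_ideal_of_gen.
Qed.

Definition closed_nowhere_dense (T : topologicalType) (F : set T) :=
  closed F /\ F° = set0.

Definition meager (T : topologicalType) :=
  sigma_ideal_of (@closed_nowhere_dense T).

Lemma closed_nowhere_dense0 (T : topologicalType) :
  closed_nowhere_dense (set0 : set T).
Proof. by split; [exact: closed0|rewrite -subset0; exact: interior_subset]. Qed.

Lemma closed_nowhere_denseU (T : topologicalType) (F G : set T) :
  closed_nowhere_dense F -> closed_nowhere_dense G ->
  closed_nowhere_dense (F `|` G).
Proof.
move=> [cF F0] [cG G0]; split; first exact: closedU.
rewrite -subset0 => x FGx; rewrite -F0 /interior nbhsE.
(* an open subset of [F `|` G] minus [F] lies in [G], hence is empty *)
move: FGx; rewrite /interior nbhsE => -[U [oU Ux] UFG].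
exists U => // y Uy; apply: contrapT => nFy.
have : G° y.
  rewrite /interior nbhsE; exists (U `&` ~` F).
    by split; [apply: openI => //; rewrite openC|].
  by move=> z [/UFG[]].
by rewrite G0.
Qed.

(** * Baire category in the product with the space of integer sequences *)

Lemma mkseq_eqP (a b : nat -> nat) N :
  mkseq a N = mkseq b N <-> forall j, (j < N)%N -> a j = b j.
Proof.
split=> [ab j jN|ab]; first by rewrite -(nth_mkseq 0%N a jN) ab nth_mkseq.
apply: (@eq_from_nth _ 0%N) => [|j]; rewrite ?size_mkseq// => jN.
by rewrite !nth_mkseq// ab.
Qed.

Section BaireCategory.
Context {R : realType} {Y : metricType R}.
Implicit Types Z : Y -> (nat -> nat) -> Prop.

(** Closedness in the product of [Y] and the Baire space of integer sequences,
    whose basic neighborhoods of [a] are given by the prefixes of [a]. *)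
Definition closed_rel Z := forall x a, ~ Z x a ->
  exists N, \forall y \near x, forall b, mkseq b N = mkseq a N -> ~ Z y b.

(** If no piece of [Z] projected into a [C n], one could choose points of [Z]
    in shrinking balls avoiding [C 0], [C 1], ... in turn, with longer and
    longer stable prefixes; the limit would be a point of [Z] outside every
    [C n]. *)
Lemma baire_closed_rel Z x0 a0 (C : nat -> set Y) :
  complete_distance (@mdist R Y) -> closed_rel Z -> Z x0 a0 ->
  (forall n, closed (C n)) -> (forall x a, Z x a -> exists n, C n x) ->
  exists n x a V N, [/\ Z x a, nbhs x V &
    forall y b, V y -> mkseq b N = mkseq a N -> Z y b -> C n y].
Proof.
move=> Yc Zc Z0 Cc ZC; apply: contrapT => nZ.
have /choice[next nextP] : forall p : nat * (Y * (nat -> nat) * R),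
    exists q : Y * (nat -> nat) * R,
    Z p.2.1.1 p.2.1.2 -> 0 < p.2.2 ->
    [/\ Z q.1.1 q.1.2, 0 < q.2, q.2 <= p.1.+2%:R^-1,
        mkseq q.1.2 p.1 = mkseq p.2.1.2 p.1 &
        forall z, mdist q.1.1 z <= q.2 ->
          mdist p.2.1.1 z <= p.2.2 /\ ~ C p.1 z].
  move=> [n [[x a] r]] /=; have [[Zx r0]|nZr] := pselect (Z x a /\ 0 < r);
    last by exists (x, a, r) => Zx r0; case: nZr.
  have [y [b [xy ba Zy nCy]]] :
      exists y b, [/\ mdist x y < r, mkseq b n = mkseq a n, Z y b & ~ C n y].
    apply: contrapT => nyb; apply: nZ.
    exists n, x, a, [set y | mdist x y < r], n; split=> //.
      by apply/nbhs_mdistP; exists r.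
    by move=> y b xy ba Zy; apply: contrapT => nCy; apply: nyb; exists y, b.
  have : nbhs y ([set z | mdist x z < r] `&` ~` C n).
    apply: open_nbhs_nbhs; split=> //; apply: openI; first exact: open_mdist_lt.
    by rewrite openC.
  move=> /nbhs_mdistP[e e0 ye].
  exists (y, b, Num.min (e / 2) n.+2%:R^-1) => _ _; split=> //=.
  - by rewrite lt_min divr_gt0//= invr_gt0 ltr0n.
  - by rewrite ge_min lexx orbT.
  - move=> z; rewrite le_min => /andP[yz _].
    have [|/= /ltW ? ?] := ye z; [lra|by split].
pose st := fix st n := if n is m.+1 then next (m, st m) else (x0, a0, 1).
pose x n := (st n).1.1; pose a n := (st n).1.2; pose r n := (st n).2.
have stP n : Z (x n) (a n) /\ 0 < r n.
  by elim: n => [|n [Zn rn]]; [split|have [] := nextP (n, st n) Zn rn].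
have stS n : [/\ r n.+1 <= n.+2%:R^-1, mkseq (a n.+1) n = mkseq (a n) n &
    forall z, mdist (x n.+1) z <= r n.+1 -> mdist (x n) z <= r n /\ ~ C n z].
  by have [Zn rn] := stP n; have [] := nextP (n, st n) Zn rn.
have nested n m z : (n <= m)%N -> mdist (x m) z <= r m -> mdist (x n) z <= r n.
  move=> /subnK <-; elim: (m - n)%N => [|k IH]; rewrite ?addSn//.
  by move=> kz; apply: IH; have [_ _ /(_ z kz)[]] := stS (k + n)%N.
have [|n m nm|l [xl lr]] := @complete_shrinking_balls _ _ x x r Yc.
- by case=> [|n]; [rewrite invr1 /r|case: (stS n)].
- by apply: nested nm _; rewrite mdistxx ltW//; case: (stP m).
pose al j := a j.+1 j.
have aal j m : (j < m)%N -> a m j = al j.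
  move=> /subnK <-; elim: (m - j.+1)%N => [|k IH]; rewrite ?addSn//.
  rewrite -IH; have [_ /mkseq_eqP-> //] := stS (k + j.+1)%N.
  by rewrite addnS ltnS leq_addl.
have Zl : Z l al.
  apply: contrapT => /Zc[N /nbhs_mdistP[e e0 le]].
  have [M Ml] := xl _ e0; have [Zm _] := stP (maxn M N).
  apply: le Zm; first by rewrite metric_sym; exact: Ml (leq_maxl _ _).
  apply/mkseq_eqP => j jN; rewrite aal//; lia.
have [n Cl] := ZC _ _ Zl; have [_ _ /(_ l (lr n.+1))[]] := stS n; done.
Qed.

Lemma closed_rel_closed (G : set Y) : closed G -> closed_rel (fun y _ => G y).
Proof.
rewrite -openC openE => Go y a Gy; exists 0%N.
by have := Go y Gy; apply: filterS.
Qed.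

Lemma baire_category (V : set Y) : complete_distance (@mdist R Y) ->
  open V -> V !=set0 -> ~ meager V.
Proof.
move=> Yc oV [x Vx] [F Fcnd VF].
have /nbhs_mdistP[e e0 xe] : nbhs x V by exact: open_nbhs_nbhs.
pose U := [set y | mdist x y < e / 2].
have Ux : U x by rewrite /U /= mdistxx divr_gt0.
have clUV : closure U `<=` V.
  have Ule : U `<=` [set y | mdist x y <= e / 2] by move=> y /ltW.
  move=> y /(closureS Ule)/closed_mdist_le /= xy; apply: xe; lra.
have := @baire_closed_rel _ x (fun=> 0%N) F Yc
  (closed_rel_closed (@closed_closure _ U)) (subset_closure Ux).
case=> [n|y _ /clUV/VF[n _ Fy]|n [y [a [W [N [Uy Wy Wn]]]]]].
- by have [] := Fcnd n.
- by exists n.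
(* [y] may lie on the boundary of [U], but [W] meets [U] *)
have [z [Uz Wz]] := Uy _ (nbhs_interior Wy).
have [_ Fn0] := Fcnd n; suff : (F n)° z by rewrite Fn0.
have Uoz : nbhs z U.
  by apply: open_nbhs_nbhs; split; first exact: open_mdist_lt.
apply: filterS (filterI Uoz Wz) => t [Ut Wt].
by apply: (Wn t a) => //; exact: subset_closure.
Qed.

End BaireCategory.

(** * Analytic sets *)

Section Analytic.
Context {R : realType} {Y : metricType R}.
Implicit Types (A : set Y) (Z : Y -> (nat -> nat) -> Prop).

Definition analytic A :=
  exists2 Z, closed_rel Z & forall x, A x <-> exists a, Z x a.

(** The points of [A] are those with a ball of some radius [1 / n.+1] inside
    [A]; the sequence guesses [n] in its first entry. *)
Lemma open_analytic A : open A -> analytic A.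
Proof.
move=> oA.
exists (fun x a => forall y, mdist x y < (a 0%N).+1%:R^-1 -> A y).
  move=> x a /existsNP[y] /not_implyP[xy nAy]; exists 1%N.
  have : open [set z | mdist y z < (a 0%N).+1%:R^-1] by exact: open_mdist_lt.
  rewrite openE => /(_ x); rewrite /= (metric_sym y x) => /(_ xy).
  apply: filterS => z /= yz b /mkseq_eqP ba Zb; apply/nAy/Zb.
  by rewrite ba// metric_sym.
move=> x; split=> [Ax|[a]]; last by apply; rewrite mdistxx.
have /nbhs_mdistP[e e0 eA] : nbhs x A by exact: open_nbhs_nbhs.
have [n ne] := invS_lt e0; exists (fun=> n) => y xy; apply: eA.
exact: lt_trans ne.
Qed.

(** A witness for the union is an index followed by a witness for that
    member. *)
Lemma analytic_bigcup (A : nat -> set Y) :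
  (forall n, analytic (A n)) -> analytic (\bigcup_n A n).
Proof.
move=> /(_ _)/cid2-/all_sig2[Z Zc ZA].
exists (fun x a => Z (a 0%N) x (fun k => a k.+1)).
  move=> x a /Zc[N xN]; exists N.+1; apply: filterS xN => y yN b /mkseq_eqP ba.
  rewrite ba//; apply: yN; apply/mkseq_eqP => j jN; exact: ba.
move=> x; split=> [[n _ /ZA[a Za]]|[a Za]].
  by exists (fun k => if k is j.+1 then a j else n).
by exists (a 0%N) => //; apply/ZA; exists (fun k => a k.+1).
Qed.

(** A witness for the intersection codes a sequence of witnesses through the
    pairing of natural numbers; each entry of each of them depends on finitely
    many entries of the code. *)
Lemma analytic_bigcap (A : nat -> set Y) :
  (forall n, analytic (A n)) -> analytic (\bigcap_n A n).
Proof.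
move=> /(_ _)/cid2-/all_sig2[Z Zc ZA].
exists (fun x a => forall n, Z n x (fun k => a (pickle (n, k)))).
  move=> x a /existsNP[n /Zc[N xN]].
  exists (\max_(j < N) (pickle (n, j : nat)).+1)%N.
  apply: filterS xN => y yN b /mkseq_eqP ba; apply/existsNP; exists n.
  apply: yN; apply/mkseq_eqP => j jN; apply: ba.
  exact: (@leq_bigmax _ (fun j : 'I_N => (pickle (n, j : nat)).+1)
    (Ordinal jN)).
move=> x; split=> [Ax|[a Za] n _]; last first.
  by apply/ZA; exists (fun k => a (pickle (n, k))).
have /choice[a aP] : forall n, exists a, Z n x a by move=> n; apply/ZA/Ax.
exists (fun k => if unpickle k is Some (n, j) then a n j else 0%N) => n.
rewrite (_ : (fun k => _) = a n)//; apply/funext => k; by rewrite pickleK.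
Qed.

Lemma borel_analytic A : borel_set A -> analytic A.
Proof.
suff : @borel_set Y `<=` [set A | analytic A /\ analytic (~` A)].
  by move=> sub /sub[].
apply: smallest_sub => [|U oU]; last first.
  split; first exact: open_analytic.
  exists (fun x _ => ~ U x); last first.
    by move=> x; split=> [|[]//]; exists (fun=> 0%N).
  by apply: (@closed_rel_closed _ _ (~` U)); rewrite closedC.
split=> [|B [aB aBC]|B aB].
- rewrite /= setC0; split; first by apply: open_analytic; exact: open0.
  by apply: open_analytic; exact: openT.
- by rewrite /= setTD setCK.
- split; first by apply: analytic_bigcup => n; case: (aB n).
  by rewrite /= setC_bigcup; apply: analytic_bigcap => n; case: (aB n).
Qed.

(** Let [I] be a sigma-ideal and [A] the projection of the closed relation
    [Z].  Removing from [Z] all basic boxes over which [Z] projects into [I]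
    leaves a closed relation [F]; only countably many boxes are removed, so
    every box meeting [F] has a trace of [F] projecting out of [I].  The [E k]
    are the projections of these traces, and category in [F] puts one of them
    inside a member of any countable closed cover of [A]. *)
Theorem analytic_notin_sigma_ideal (B : nat -> set Y) (P : set Y -> Prop) A :
  complete_distance (@mdist R Y) -> (forall m, open (B m)) ->
  countable_base B -> P set0 -> analytic A -> ~ sigma_ideal_of P A ->
  exists2 E : nat -> set Y, forall k, E k `<=` A /\ ~ sigma_ideal_of P (E k) &
    forall C : nat -> set Y, (forall n, closed (C n)) -> A `<=` \bigcup_n C n ->
      exists k n, E k `<=` C n.
Proof.
move=> Yc oB Bb P0 [Z Zc ZA] nPA.
pose box m s (W : Y -> (nat -> nat) -> Prop) :=
  [set x | B m x /\ exists2 a, mkseq a (size s) = s & W x a].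
pose small m s := sigma_ideal_of P (box m s Z).
pose F x a := Z x a /\ forall m s, B m x -> mkseq a (size s) = s -> ~ small m s.
have Fc : closed_rel F.
  move=> x a nF; have [/Zc[N xN]|/contrapT Zx] := pselect (~ Z x a).
    by exists N; apply: filterS xN => y yN b /yN nZ [].
  have [m [s [Bx sa ms]]] :
      exists m s, [/\ B m x, mkseq a (size s) = s & small m s].
    apply: contrapT => H; apply: nF; split=> // m s Bx sa ms.
    by apply: H; exists m, s.
  exists (size s); apply: filterS (open_nbhs_nbhs (conj (oB m) Bx)) => y By b.
  by rewrite sa => sb [_ /(_ m s By sb)].
pose rem k := if unpickle k is Some (m, s) then
  if pselect (small m s) then box m s Z else set0 else set0.
have smallrem : sigma_ideal_of P (\bigcup_k rem k).
  apply: sigma_ideal_of_bigcup => // k; rewrite /rem.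
  case: (unpickle k) => [[m s]|]; last exact: sigma_ideal_of_gen.
  by case: pselect => /= [//|_]; exact: sigma_ideal_of_gen.
have ZF x a : Z x a -> F x a \/ (\bigcup_k rem k) x.
  move=> Zx; have [|nr] := pselect ((\bigcup_k rem k) x); [by right|left].
  split=> // m s Bx sa ms; apply: nr; exists (pickle (m, s)) => //.
  by rewrite /rem pickleK; case: pselect => //= _; split=> //; exists a.
have boxF m s : box m s F !=set0 -> ~ sigma_ideal_of P (box m s F).
  move=> [x [Bx [a sa [Zx /(_ m s Bx sa) nms]]]] PF; apply: nms.
  apply: sigma_ideal_ofS (sigma_ideal_ofU P0 PF smallrem) => y [By [b sb]].
  by move=> /ZF[Fy|]; [left; split=> //; exists b|right].
have [x0 [a0 F0]] : exists x a, F x a.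
  apply: contrapT => nF; apply: nPA; apply: sigma_ideal_ofS smallrem => x.
  by move=> /ZA[a /ZF[Fx|//]]; case: nF; exists x, a.
have FA x a : F x a -> A x by move=> [Zx _]; apply/ZA; exists a.
exists (fun k => if unpickle k is Some (m, s) then
    if pselect (box m s F !=set0) then box m s F else A else A) => [k|C Cc AC].
  have AA : A `<=` A /\ ~ sigma_ideal_of P A by split.
  case: (unpickle k) => [[m s]|//]; case: pselect => //= ms.
  by split; [move=> x [_ [a _ /FA]]|exact: boxF].
have [|n [x [a [V [N [Fx xV VC]]]]]] := baire_closed_rel Yc Fc F0 Cc.
  by move=> x a /FA/AC[n _ Cx]; exists n.
have [m Bx BV] := Bb _ _ xV.
exists (pickle (m, mkseq a N)), n; rewrite pickleK; case: pselect => /= [_|[]].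
  by move=> y [/BV Vy [b]]; rewrite size_mkseq => ba; exact: VC.
by exists x; split=> //; exists a => //; rewrite size_mkseq.
Qed.

End Analytic.

(** * The Baire property of Borel sets *)

Section BaireProperty.
Context {T : topologicalType}.
Implicit Types A O : set T.

Lemma meager_frontier O : open O -> meager (closure O `\` O).
Proof.
move=> oO; apply: sigma_ideal_of_gen; split.
  by rewrite setDE; apply: closedI; [exact: closed_closure|rewrite closedC].
rewrite -subset0 => x xO; have [Ox nOx] := nbhs_singleton xO.
by have [y [Oy [_ /(_ Oy)]]] := Ox _ xO.
Qed.

Lemma borel_baire_property A : borel_set A ->
  exists2 O, open O & meager (A `\` O `|` O `\` A).
Proof.
have meagerU (M N : set T) : meager M -> meager N -> meager (M `|` N).
  exact: sigma_ideal_ofU (@closed_nowhere_dense0 T).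
apply: (@smallest_sub _ _ _
  [set A | exists2 O, open O & meager (A `\` O `|` O `\` A)]); last first.
  move=> U oU; exists U => //; rewrite !setDv setU0.
  exact/sigma_ideal_of_gen/closed_nowhere_dense0.
split=> [|B [V oV mV]|B Bn].
- exists set0; first exact: open0.
  rewrite !setDv setU0; exact/sigma_ideal_of_gen/closed_nowhere_dense0.
- exists (~` closure V); first by rewrite openC; exact: closed_closure.
  apply: sigma_ideal_ofS (meagerU _ _ mV (meager_frontier oV)) => x.
  move=> [[[_ nBx] /contrapT Vx]|[nVx /not_andP[/(_ I)//|/contrapT Bx]]].
    by have [Vo|nVo] := pselect (V x); [left; right|right].
  by left; left; split=> [|/subset_closure].
- have [V oV mV] := all_sig2 (fun n => cid2 (Bn n)).
  exists (\bigcup_n V n); first by apply: bigcup_open => n _.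
  apply: (@sigma_ideal_ofS _ _ _ (\bigcup_n (B n `\` V n `|` V n `\` B n))).
    move=> x [[[n _ Bx] nVx]|[[n _ Vx] nBx]]; exists n => //.
      by left; split=> // Vx; apply: nVx; exists n.
    by right; split=> // Bx; apply: nBx; exists n.
  exact: sigma_ideal_of_bigcup (@closed_nowhere_dense0 T) mV.
Qed.

End BaireProperty.

(** * Dense isometric embeddings and homeomorphisms *)

Section DenseEmbedding.
Context {R : realType} {X Y : metricType R} (i : X -> Y).
Hypothesis iso : forall x y, mdist (i x) (i y) = mdist x y.

Lemma isometry_inj : injective i.
Proof.
by move=> x y ixy; apply: mdist_positivity; rewrite -iso ixy mdistxx.
Qed.

Lemma isometry_continuous : continuous i.
Proof.
move=> x V /nbhs_mdistP[e e0 eV]; apply/nbhs_mdistP; exists e => // y xy.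
by apply: eV; rewrite iso.
Qed.

Lemma isometry_openP (U : set X) : open U <-> exists2 V, open V & U = i @^-1` V.
Proof.
split=> [oU|[V oV ->]]; last by move/continuousP: isometry_continuous; apply.
exists (\bigcup_(V in [set V | open V /\ i @^-1` V `<=` U]) V).
  by apply: bigcup_open => V [].
apply/seteqP; split=> [x Ux|x [V [_]]]; last exact.
have /nbhs_mdistP[e e0 xe] : nbhs x U by exact: open_nbhs_nbhs.
exists [set y | mdist (i x) y < e]; last by rewrite /= mdistxx.
by split; [exact: open_mdist_lt|move=> y /=; rewrite iso; exact: xe].
Qed.

Lemma isometry_closure (C : set X) x :
  closed C -> closure (i @` C) (i x) -> C x.
Proof.
move=> cC clx; apply: cC => U /nbhs_mdistP[e e0 xe].
have [|_ [[y Cy <-] xy]] := clx [set z | mdist (i x) z < e].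
  by apply/nbhs_mdistP; exists e.
by exists y; split=> //; apply: xe; rewrite -iso.
Qed.

Hypothesis dense_i : dense (range i).

Lemma open_meets_range (V : set Y) y : open V -> V y -> exists x, V (i x).
Proof.
move=> oV Vy.
have [|//|z [Vz [x _ ixz]]] := dense_i (O := V); first by exists y.
by exists x; rewrite ixz.
Qed.

(** Nowhere density passes between [X] and [Y] because the open sets of [X] are
    the traces of those of [Y], and [range i] meets every nonempty one. *)
Lemma meager_preimage (M : set Y) : meager M -> meager (i @^-1` M).
Proof.
move=> [F Fcnd MF]; exists (fun n => i @^-1` F n); last first.
  by move=> x /MF[n _ Fx]; exists n.
move=> n; have [Fc F0] := Fcnd n; split.
  by move/continuous_closedP: isometry_continuous; apply.
rewrite -subset0 => x; rewrite /interior nbhsE.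
move=> -[U [/isometry_openP[V oV ->] Vx] VF].
have : (F n)° (i x); last by rewrite F0.
rewrite /interior nbhsE; exists V => // y Vy; apply: contrapT => nFy.
have [|//|z [Vz]] := @open_meets_range (V `&` ~` F n) y.
  by apply: openI => //; rewrite openC.
by apply; exact: VF.
Qed.

Lemma meager_image (M : set X) : meager M -> meager (i @` M).
Proof.
move=> [F Fcnd MF]; exists (fun n => closure (i @` F n)); last first.
  move=> _ [x /MF[n _ Fx] <-]; exists n => //.
  by apply: subset_closure; exists x.
move=> n; have [Fc F0] := Fcnd n; split; first exact: closed_closure.
rewrite -subset0 => y; rewrite /interior nbhsE => -[V [oV Vy] VF].
have [x Vx] := open_meets_range oV Vy.
have : (F n)° x; last by rewrite F0.
rewrite /interior nbhsE; exists (i @^-1` V).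
  by split=> //; apply/isometry_openP; exists V.
by move=> z /VF; exact: isometry_closure.
Qed.

Lemma dense_isometry_image (D : set X) : dense D -> dense (i @` D).
Proof.
move=> Dd V [y Vy] oV; have [x Vx] := open_meets_range oV Vy.
have [||z [Vz Dz]] := Dd (i @^-1` V); first by exists x.
  by apply/isometry_openP; exists V.
by exists (i z); split=> //; exists z.
Qed.

End DenseEmbedding.

Section Homeomorphism.
Context {T : topologicalType} (h g : T -> T).
Hypotheses (hK : cancel h g) (gK : cancel g h).
Hypotheses (hc : continuous h) (gc : continuous g).

Lemma image_homeo (A : set T) : h @` A = g @^-1` A.
Proof.
apply/seteqP; split=> [_ [x Ax <-]|x Ax]; first by rewrite /= hK.
by exists (g x).
Qed.

Lemma open_image_homeo (A : set T) : open A -> open (h @` A).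
Proof. by rewrite image_homeo; move/continuousP: gc; apply. Qed.

Lemma closed_image_homeo (A : set T) : closed A -> closed (h @` A).
Proof. by rewrite image_homeo; move/continuous_closedP: gc; apply. Qed.

Lemma meager_image_homeo (M : set T) : meager M -> meager (h @` M).
Proof.
move=> [F Fcnd MF]; exists (fun n => h @` F n); last first.
  by move=> _ [x /MF[n _ Fx] <-]; exists n => //; exists x.
move=> n; have [Fc F0] := Fcnd n; split; first exact: closed_image_homeo.
rewrite -subset0 => x; rewrite image_homeo => xF.
have : (F n)° (g x); last by rewrite F0.
rewrite /interior.
have : nbhs (g x) (h @^-1` (g @^-1` F n)) by apply: hc; rewrite gK.
by apply: filterS => y /=; rewrite hK.
Qed.

End Homeomorphism.

(** * Countable sets and countable dense subsets *)

Lemma countable_preimage T U (f : T -> U) (A : set U) :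
  injective f -> countable A -> countable (f @^-1` A).
Proof.
move=> finj /countable_injP[c cinj]; apply/countable_injP; exists (c \o f).
by move=> x y; rewrite !inE => Ax Ay /cinj/finj; apply; rewrite inE.
Qed.

Lemma countableU T (A B : set T) :
  countable A -> countable B -> countable (A `|` B).
Proof.
move=> cA cB; rewrite -bigcup2E; apply: bigcup_countable => // -[|[|n]] _ //=.
Qed.

Lemma countable_of_sigma_ideal T (A : set T) :
  sigma_ideal_of (fun B : set T => countable B) A -> countable A.
Proof.
move=> [F Fc AF]; apply: sub_countable (subset_card_le AF) _.
by apply: bigcup_countable.
Qed.

Lemma infinite_countable_subset T (A : set T) : infinite_set A ->
  exists B, [/\ B `<=` A, countable B & infinite_set B].
Proof.
move=> /infiniteP/card_subP[B BN BA]; exists B; split=> //.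
  by rewrite (eq_countable BN); exact: countableP.
by apply/infiniteP; rewrite card_eq_sym card_eq_le in BN; case/andP: BN.
Qed.

(** The last clause, finiteness of the traces on sets avoided by almost all
    [A k], is what makes the selected sets thin. *)
Lemma countable_selection T (A : nat -> set T) :
  exists d : set T, [/\ countable d, d `<=` \bigcup_k A k,
    forall k, A k !=set0 -> exists2 x, d x & A k x &
    forall n (N : set T), (forall k, (n <= k)%N -> A k `<=` ~` N) ->
      finite_set (d `&` N)].
Proof.
have [[x0 _]|nT] := pselect (exists x : T, True); last first.
  exists set0; split=> [//|//|k [x]|n N _]; last by rewrite set0I.
  by case: nT; exists x.
have /choice[f fP] : forall k, exists x, A k !=set0 -> A k x.
  by move=> k; have [[x]|] := pselect (A k !=set0); [exists x|exists x0].
pose K := [set k | A k !=set0].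
exists (f @` K); split=> [|_ [k Ak <-]|k Ak|n N AN].
- by apply: sub_countable (card_image_le _ _) _; exact: countableP.
- by exists k => //; exact: fP.
- by exists (f k); [exists k|exact: fP].
- apply: sub_finite_set (finite_image f (finite_II n)) => _ [[k Ak <-] Nk].
  exists k => //=; rewrite ltnNge; apply/negP => nk.
  by apply: AN nk _ _ Nk; exact: fP.
Qed.

(** Density of [D] in [G] is expressed with the open sets of the ambient
    space. *)
Lemma countable_dense_subset (T : topologicalType) (B : nat -> set T)
    (G : set T) :
  countable_base B ->
  exists D, [/\ countable D, D `<=` G &
    forall V, open V -> V `&` G !=set0 -> V `&` D !=set0].
Proof.
move=> Bb; have [D [cD DG Dd _]] := countable_selection (fun k => B k `&` G).
exists D; split=> // [x /DG[k _ []]//|V oV [x [Vx Gx]]].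
have [|k Bx BV] := Bb x V; first exact: open_nbhs_nbhs.
by have [|y Dy [/BV Vy _]] := Dd k; [exists x|exists y].
Qed.

(** The [k]-th point of [D] is taken in the [k]-th basic open set, outside
    [N 0], ..., [N k]; this is possible because finite unions of closed nowhere
    dense sets are nowhere dense. *)
Lemma thin_countable_dense (T : topologicalType) (B : nat -> set T) (U : set T)
    (N : nat -> set T) :
  countable_base B -> (forall m, open (B m)) ->
  (forall n, closed_nowhere_dense (N n)) ->
  exists D, [/\ countable D, D `<=` U, forall n, finite_set (D `&` N n) &
    forall V, open V -> V `<=` U -> V !=set0 -> V `&` D !=set0].
Proof.
move=> Bb oB Ncnd; pose M k := \big[setU/set0]_(n < k) N n.
have Mcnd k : closed_nowhere_dense (M k).
  rewrite /M; elim/big_ind: _ => [|E F|n _]; last exact: Ncnd.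
    exact: closed_nowhere_dense0.
  exact: closed_nowhere_denseU.
have NM n k : (n < k)%N -> N n `<=` M k.
  by move=> nk x Nx; rewrite /M -bigcup_mkord; exists n.
have [D [cD DA Dd Df]] :=
  countable_selection (fun k => B k `&` U `&` ~` M k.+1).
exists D; split=> // [x /DA[k _ [[]]]//|n|V oV VU [x Vx]].
  apply: (Df n) => k nk x [_ nMx] Nx; apply: nMx; exact: NM Nx.
have [|k Bx BV] := Bb x V; first exact: open_nbhs_nbhs.
have [y By nMy] : exists2 y, B k y & ~ M k.+1 y.
  apply: contrapT => BM; have [_] := Mcnd k.+1; apply/eqP/set0P; exists x.
  rewrite /interior nbhsE; exists (B k) => // y By.
  by apply: contrapT => nMy; apply: BM; exists y.
have [|z Dz [[/BV Vz _] _]] := Dd k; last by exists z.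
by exists y; split=> //; split=> //; exact/VU/BV.
Qed.

(** * The meager part of a countable dense homogeneous Borel space *)

Lemma homeomorphism_inv (T : topologicalType) (h : T -> T) : homeomorphism h ->
  exists g, [/\ homeomorphism g, cancel h g, cancel g h, continuous h &
    continuous g].
Proof. by move=> [g [hK gK hc gc]]; exists g; split=> //; exists h. Qed.

Section MeagerPart.
Context {R : realType} {X Y : metricType R} (i : X -> Y).
Hypothesis iso : forall x y, mdist (i x) (i y) = mdist x y.
Hypothesis dense_i : dense (range i).
Hypothesis Yc : complete_distance (@mdist R Y).
Variables (O : set Y) (F : nat -> set Y).
Hypotheses (oO : open O) (Fcnd : forall n, closed_nowhere_dense (F n)).
Hypothesis OF : range i `\` O `|` O `\` range i `<=` \bigcup_n F n.

Definition meager_part := i @^-1` (~` closure O).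
Definition generic_part := O `&` ~` \bigcup_n F n.
Local Notation U := meager_part.
Local Notation G := generic_part.

Lemma meager_remainder : meager (\bigcup_n F n).
Proof. by exists F. Qed.

Lemma generic_in_range : G `<=` range i.
Proof.
move=> y [Oy nFy]; apply: contrapT => niy; apply: nFy.
by apply: OF; right.
Qed.

Lemma generic_dense V : open V -> V `&` O !=set0 -> V `&` G !=set0.
Proof.
move=> oV VO; apply: contrapT => nVG.
have : ~ meager (V `&` O) by apply: baire_category => //; exact: openI.
apply; exists F => // y [Vy Oy]; apply: contrapT => nFy.
by apply: nVG; exists y.
Qed.

Lemma open_meager_part : open U.
Proof.
apply/(isometry_openP iso); exists (~` closure O) => //.
by rewrite openC; exact: closed_closure.
Qed.

Lemma meager_part_cover : i @` U `<=` \bigcup_n F n.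
Proof.
move=> _ [x Ux <-]; apply: OF; left; split; first by exists x.
by move=> Oix; apply: Ux; exact: subset_closure.
Qed.

(** [U] is the largest meager open set: an open set of [X] reaching [closure O]
    contains all points of [range i] in a nonempty open subset of [O], where
    [range i] is comeager, so it is not meager. *)
Lemma meager_open_sub (W : set X) : open W -> meager W -> W `<=` U.
Proof.
move=> /(isometry_openP iso)[V oV ->] mV x Vx clOx.
have [y [Oy Vy]] := clOx _ (open_nbhs_nbhs (conj oV Vx)).
have : ~ meager (V `&` O).
  by apply: baire_category => //; [exact: openI|exists y].
apply; apply: sigma_ideal_ofS (sigma_ideal_ofU (@closed_nowhere_dense0 Y)
  (meager_image iso dense_i mV) meager_remainder).
move=> z [Vz Oz]; have [[t _ tz]|nz] := pselect (range i z).
  by left; exists t => //; rewrite /= tz.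
by right; apply: OF; right.
Qed.

Lemma homeo_meager_part (h : X -> X) : homeomorphism h -> h @` U `<=` U.
Proof.
move=> [g [hK gK hc gc]]; apply: meager_open_sub.
  exact: (open_image_homeo hK gK gc open_meager_part).
apply: (meager_image_homeo hK gK hc gc).
apply: sigma_ideal_ofS (meager_preimage iso dense_i meager_remainder).
by move=> x Ux; apply: meager_part_cover; exists x.
Qed.

Lemma homeo_meager_partE (h : X -> X) x : homeomorphism h -> U (h x) <-> U x.
Proof.
move=> hh; split=> Ux; last by apply: homeo_meager_part hh _ _; exists x.
have [g [gh hK _ _ _]] := homeomorphism_inv hh.
by rewrite -(hK x); apply: homeo_meager_part gh _ _; exists (h x).
Qed.

Variable D2 : set X.
Hypothesis D2G : i @` D2 `<=` G.
Hypothesis D2d : forall V, open V -> V `&` G !=set0 -> V `&` (i @` D2) !=set0.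

Lemma generic_notin_meager_part x : D2 x -> ~ U x.
Proof.
move=> Dx; apply; apply: subset_closure.
by have [] : G (i x) by apply: D2G; exists x.
Qed.

Lemma dense_from_meager_part (D : set X) : D2 `<=` D ->
  (forall V, open V -> V `<=` U -> V !=set0 -> V `&` D !=set0) -> dense D.
Proof.
move=> D2D DU W W0 oW; have [WU|] := pselect (W `<=` U); first exact: DU.
move=> /existsNP[x /not_implyP[Wx /contrapT clOx]].
move: oW Wx => /(isometry_openP iso)[V oV ->] Vx.
have [y [Oy Vy]] := clOx _ (open_nbhs_nbhs (conj oV Vx)).
have [|t [Vz [z Dz iz]]] := D2d oV; last first.
  by exists z; split; [rewrite /= iz|exact: D2D].
by apply: generic_dense => //; exists y.
Qed.

Variable BX : nat -> set X.
Hypotheses (oBX : forall m, open (BX m)) (BXb : countable_base BX).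
Variable BY : nat -> set Y.
Hypotheses (oBY : forall m, open (BY m)) (BYb : countable_base BY).
Hypothesis Ran : analytic (range i).
Hypothesis cD2 : countable D2.
Hypothesis cdh : countable_dense_homogeneous X.

Lemma analytic_meager_part : analytic (i @` U).
Proof.
rewrite (_ : i @` U = \bigcap_n bigcap2 (range i) (~` closure O) n).
  apply: analytic_bigcap => -[|[|n]] //=; apply: open_analytic.
    by rewrite openC; exact: closed_closure.
  exact: openT.
rewrite bigcap2E; apply/seteqP; split=> [_ [x Ux <-]|_ [[x _ <-] Ux]].
  by split=> //; exists x.
by exists x.
Qed.

(** If [U] is uncountable, it has uncountable subsets [E k], one of which lies
    in a member of any countable closed cover of [U].  A thin dense set [D]
    cannot be exchanged with a dense set containing infinitely many points of
    each [E k]: [U] is covered by countably many closed sets with finite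
    traces on the first, but not on the second. *)
Lemma countable_meager_part : countable U.
Proof.
apply: contrapT => nU.
have [N Ncnd UN] : exists2 N : nat -> set X,
    forall n, closed_nowhere_dense (N n) & U `<=` \bigcup_n N n.
  have [N NP UN] := meager_preimage iso dense_i meager_remainder.
  exists N => // x Ux; apply: UN; apply: meager_part_cover; by exists x.
have [D1 [cD1 D1U D1N D1d]] := thin_countable_dense U BXb oBX Ncnd.
have [|E EU Ecover] := analytic_notin_sigma_ideal
  (P := fun B : set Y => countable B) Yc oBY BYb (@countable0 Y)
  analytic_meager_part.
  move=> /countable_of_sigma_ideal/(countable_preimage (isometry_inj iso)).
  rewrite (_ : i @^-1` (i @` U) = U)//; apply/seteqP; split=> x.
    by move=> [y Uy /(isometry_inj iso)<-].
  by exists x.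
have Einf k : infinite_set (E k).
  move=> /finite_set_countable cE; have [_] := EU k; apply.
  exact: sigma_ideal_of_gen.
have /choice[Q QP] : forall k,
    exists Q, [/\ Q `<=` E k, countable Q & infinite_set Q].
  by move=> k; exact: infinite_countable_subset.
pose D := D1 `|` D2; pose D' := D `|` i @^-1` (\bigcup_k Q k).
have cD : countable D by exact: countableU.
have Dd : dense D.
  apply: dense_from_meager_part; first by move=> x; right.
  by move=> V oV VU /(D1d V oV VU)[x [Vx Dx]]; exists x; split=> //; left.
have cD' : countable D'.
  apply: countableU => //; apply: countable_preimage; first exact: isometry_inj.
  by apply: bigcup_countable => // k _; case: (QP k).
have Dd' : dense D'.
  by move=> V V0 oV; have [x [Vx Dx]] := Dd V V0 oV; exists x; split=> //; left.
have [h [hh hD]] := cdh.2 D D' cD Dd cD' Dd'.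
have [g [gh hK gK hc gc]] := homeomorphism_inv hh.
have clN n : closed (h @` N n).
  by apply: (closed_image_homeo hK gK gc); case: (Ncnd n).
have [||k [n EN]] := Ecover (fun n => closure (i @` (h @` N n))).
- by move=> n; exact: closed_closure.
- move=> _ [x Ux <-].
  have /UN[n _ Nx] : U (g x) by apply/(homeo_meager_partE _ gh).
  exists n => //; apply: subset_closure; exists x => //.
  by exists (g x).
have [QE _] := QP k; apply.
apply: sub_finite_set (finite_image (i \o h) (D1N n)) => y Qy.
have [x Ux xy] := (EU k).1 _ (QE _ Qy).
have [v Nv vx] : (h @` N n) x.
  by apply: (isometry_closure iso (clN n)); rewrite xy; exact/EN/QE.
exists v; last by rewrite /= vx.
split=> //; have : D' x by right; exists k => //=; rewrite xy.
rewrite -hD => -[v' Dv' v'x].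
have {v'x}v'v : v' = v by rewrite -(hK v') v'x -vx hK.
move: Dv'; rewrite v'v => -[//|/generic_notin_meager_part []].
by apply/(homeo_meager_partE _ hh); rewrite vx.
Qed.

(** The meager part is crowded, so it stays dense in itself after removal of a
    point; being countable, it could be exchanged with the result. *)
Lemma meager_part_empty : U = set0.
Proof.
rewrite -subset0 => x Ux.
pose D := U `|` D2; pose D' := (U `\ x) `|` D2.
have cU := countable_meager_part.
have cD : countable D by exact: countableU.
have cD' : countable D'.
  apply: sub_countable cD; apply: subset_card_le => y [[]|]; by [left|right].
have Dd : dense D.
  apply: dense_from_meager_part; first by move=> y; right.
  by move=> V oV VU [y Vy]; exists y; split=> //; left; exact: VU.
have Dd' : dense D'.
  apply: dense_from_meager_part; first by move=> y; right.
  move=> V oV VU [y Vy]; apply: contrapT => VD.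
  have Vx z : V z -> z = x.
    move=> Vz; apply: contrapT => zx; apply: VD; exists z; split=> //; left.
    by split; [exact: VU|].
  (* [x] would be isolated, but it lies in a nowhere dense set *)
  have [n _ Fx] : (\bigcup_n F n) (i x) by apply: meager_part_cover; exists x.
  move: oV Vx Vy => /(isometry_openP iso)[W oW ->] Wx Wy.
  have [_ Fn0] := Fcnd n; suff : (F n)° (i x) by rewrite Fn0.
  rewrite /interior nbhsE; exists W; first by split=> //; rewrite -(Wx _ Wy).
  move=> z Wz; apply: contrapT => nFz.
  have [|//|t [Wt]] := open_meets_range dense_i (V := W `&` ~` F n) (y := z).
    by apply: openI => //; rewrite openC; case: (Fcnd n).
  by rewrite (Wx t Wt); apply.
have [h [hh hD]] := cdh.2 D D' cD Dd cD' Dd'.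
have [g [gh hK gK hc gc]] := homeomorphism_inv hh.
have : D' x.
  rewrite -hD; exists (g x); last exact: gK.
  by left; apply/(homeo_meager_partE _ gh).
by move=> [[_ /(_ erefl)]|/generic_notin_meager_part].
Qed.

End MeagerPart.

(** * Complete metrizability of G-delta subspaces *)

Section FunctionMetric.
Context {R : realType} {X : metricType R} (phi : nat -> X -> R).
Hypothesis phic : forall n, continuous (phi n).

Definition gap x y n := Num.min `|phi n x - phi n y| n.+1%:R^-1.
Definition gaps x y := sup (range (gap x y)).

Lemma gap_ge0 x y n : 0 <= gap x y n.
Proof. by rewrite le_min normr_ge0/= invr_ge0. Qed.

Lemma gap_le_gaps x y n : gap x y n <= gaps x y.
Proof.
apply: ub_le_sup; last by exists n.
exists 1 => _ [m _ <-]; rewrite ge_min; apply/orP; right.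
by rewrite invf_le1 ?ltr0n// ler1n.
Qed.

Lemma gaps_le x y (e : R) : (forall n, gap x y n <= e) -> gaps x y <= e.
Proof.
move=> ge; apply: ge_sup; first by exists (gap x y 0), 0%N.
by move=> _ [n _ <-].
Qed.

Lemma gaps_ge0 x y : 0 <= gaps x y.
Proof. exact: le_trans (gap_ge0 x y 0) (gap_le_gaps x y 0). Qed.

Lemma gaps_sym x y : gaps x y = gaps y x.
Proof.
rewrite /gaps (_ : gap x y = gap y x)//.
by apply: funext => n; rewrite /gap distrC.
Qed.

Lemma gaps_triangle x y z : gaps x z <= gaps x y + gaps y z.
Proof.
apply: gaps_le => n; have := gap_le_gaps x y n; have := gap_le_gaps y z n.
have := gap_ge0 x y n; have := gap_ge0 y z n.
have := ler_distD (phi n y) (phi n x) (phi n z); rewrite /gap.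
set u := _^-1; rewrite !minEle.
by do 3 case: ifP => [|/negbT]; rewrite ?leNgt ?negbK; lra.
Qed.

Lemma near_gaps x (e : R) : 0 < e -> \forall y \near x, gaps x y <= e.
Proof.
move=> e0; have [N Ne] := invS_lt e0.
have : \forall y \near x, forall n, (n < N)%N -> `|phi n x - phi n y| < e.
  elim: N {Ne} => [|N IH]; first by apply: filterE.
  have phiN : \forall y \near x, `|phi N x - phi N y| < e.
    by move: (phic (n := N) (x := x)) => /cvgrPdist_lt; apply.
  apply: filterS (filterI IH phiN) => y [yN yNN] n.
  by rewrite ltnS leq_eqVlt => /predU1P[->//|/yN].
apply: filterS => y yN; apply: gaps_le => n; rewrite ge_min.
have [/yN/ltW->//|Nn] := ltnP n N.
by rewrite (le_trans (invS_le Nn) (ltW Ne)) orbT.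
Qed.

(** Adding the supremum of the gaps to the distance makes every [phi n]
    uniformly continuous.  It keeps the topology because the [n]-th gap is
    truncated at [1 / n.+1], so that near a point only finitely many gaps
    matter. *)
Lemma function_metric : exists d : X -> X -> R,
  [/\ is_distance d, distance_induces_topology d,
      forall x y, mdist x y <= d x y &
      forall n x y, d x y < n.+1%:R^-1 -> `|phi n x - phi n y| <= d x y].
Proof.
exists (fun x y => mdist x y + gaps x y); split.
- split=> [x y|x y|x y|x y z].
  + by rewrite addr_ge0 ?mdist_ge0 ?gaps_ge0.
  + split=> [xy|->].
      apply: mdist_positivity; have := mdist_ge0 x y; have := gaps_ge0 x y; lra.
    rewrite mdistxx add0r; apply/le_anti; rewrite gaps_ge0 andbT.
    by apply: gaps_le => n; rewrite /gap subrr normr0 ge_min lexx.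
  + by rewrite metric_sym gaps_sym.
  + have := metric_triangle x y z; have := gaps_triangle x y z; lra.
- move=> x A; split=> [/nbhs_mdistP[e e0 xe]|[e e0 xe]].
    by exists e => // y /= xy; apply: xe; have := gaps_ge0 x y; lra.
  have e20 : 0 < e / 2 by rewrite divr_gt0.
  have : nbhs x [set y | mdist x y < e / 2].
    by apply/nbhs_mdistP; exists (e / 2).
  move=> /(filterI (near_gaps x e20)); apply: filterS => y /= [xy xy'].
  by apply: xe => /=; lra.
- by move=> x y; rewrite lerDl gaps_ge0.
- move=> n x y xy; have := gap_le_gaps x y n; have := mdist_ge0 x y.
  move: xy; rewrite /gap; set u := _^-1; rewrite minEle.
  by case: ifP => _; lra.
Qed.

End FunctionMetric.

Section DistanceToSet.
Context {R : realType} {Y : metricType R} (C : set Y).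

Definition set_mdist y : R := inf [set mdist y c | c in C].

Lemma set_mdist_le y c : C c -> set_mdist y <= mdist y c.
Proof.
move=> Cc; apply: ge_inf; last by exists c.
by exists 0 => _ [z _ <-]; exact: mdist_ge0.
Qed.

Lemma set_mdist_lip y z : C !=set0 -> set_mdist y <= mdist y z + set_mdist z.
Proof.
move=> [c Cc]; rewrite -lerBlDl.
apply: lb_le_inf; first by exists (mdist z c), c.
move=> _ [c' Cc' <-].
have := metric_triangle y z c'; have := set_mdist_le y Cc'.
lra.
Qed.

Lemma set_mdist_gt0 y : C !=set0 -> closed C -> ~ C y -> 0 < set_mdist y.
Proof.
move=> [c Cc]; rewrite -openC openE => Co /Co /nbhs_mdistP[e e0 ye].
apply: lt_le_trans e0 _; apply: lb_le_inf; first by exists (mdist y c), c.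
move=> _ [c' Cc' <-]; rewrite leNgt; apply/negP => /ye; exact.
Qed.

Lemma set_mdist_continuous : C !=set0 -> continuous (set_mdist : Y -> R).
Proof.
move=> C0 y; apply/cvgrPdist_lt => e e0; apply/nbhs_mdistP; exists e => // z yz.
have := set_mdist_lip y z C0; have := set_mdist_lip z y C0.
rewrite (metric_sym z y) => ? ?; rewrite ltr_norml; apply/andP; split; lra.
Qed.

End DistanceToSet.

(** Each removed closed set [C n] is pushed to infinity: the inverse of the
    distance to [C n] is made uniformly continuous by the new metric, so it is
    bounded along Cauchy sequences, which therefore cannot converge to a point
    of [C n]. *)
Theorem gdelta_completely_metrizable (R : realType) (X Y : metricType R)
    (i : X -> Y) (C : nat -> set Y) :
  (forall x y, mdist (i x) (i y) = mdist x y) ->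
  complete_distance (@mdist R Y) -> (forall n, closed (C n)) ->
  ~` range i = \bigcup_n C n -> completely_metrizable R X.
Proof.
move=> iso Yc Cc iC.
have nC n x : ~ C n (i x).
  move=> Cx; have : (~` range i) (i x) by rewrite iC; exists n.
  by apply; exists x.
pose phi n x : R := (set_mdist (C n) (i x))^-1.
have phic n : continuous (phi n).
  have [/set0P C0|/negP/negPn/eqP C0] := pselect (C n != set0).
    move=> x; apply: cvgV; first by rewrite gt_eqF// set_mdist_gt0//; exact: nC.
    apply: (@continuous_comp _ _ _ i (set_mdist (C n))).
      exact: isometry_continuous iso x.
    exact: set_mdist_continuous.
  (* the infimum of the empty set is [0], as is its inverse *)
  have -> : phi n = fun=> 0.
    by apply/funext => x; rewrite /phi /set_mdist C0 image_set0 inf0 invr0.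
  exact: cst_continuous.
have [d [dd dt dm dphi]] := function_metric phic.
exists d; split=> // u uC.
have [e e0|y iuy] := Yc (i \o u).
  have [N uN] := uC e e0; exists N => m n Nm Nn /=.
  by rewrite iso (le_lt_trans (dm _ _))// uN.
have [x _ xy] : range i y.
  apply: contrapT => niy; have [n _ Cy] : (\bigcup_n C n) y by rewrite -iC.
  have [|N uN] := uC n.+1%:R^-1; first by rewrite invr_gt0 ltr0n.
  pose M := `|phi n (u N)| + n.+1%:R^-1.
  have M0 : 0 < M by rewrite ltr_wpDl// invr_gt0 ltr0n.
  have [|N' uN'] := iuy M^-1; first by rewrite invr_gt0.
  set m := maxn N N'.
  have dNm := uN N m (leqnn _) (leq_maxl _ _).
  have phim : phi n (u m) <= M.
    have := dphi _ _ _ dNm; have := ler_norm (phi n (u N)).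
    rewrite ler_norml => ? /andP[? ?]; move: dNm.
    by rewrite /M; set v := _^-1; lra.
  have : set_mdist (C n) (i (u m)) < M^-1.
    exact: le_lt_trans (set_mdist_le _ Cy) (uN' m (leq_maxr _ _)).
  have s0 : 0 < set_mdist (C n) (i (u m)).
    by apply: set_mdist_gt0 => //; exists y.
  by rewrite -ltf_pV2 ?posrE ?invr_gt0// invrK ltNge phim.
exists x => e e0.
have [_ _ dsym _] := dd.
have /nbhs_mdistP[e' e'0 xe'] : nbhs x [set z | d x z < e].
  by apply/dt; exists e.
have [N uN] := iuy e' e'0; exists N => n Nn; rewrite dsym; apply: xe'.
by rewrite -iso metric_sym xy; exact: uN.
Qed.

(** * Homeomorphic images of G-delta sets *)

(** The argument is that of Lavrentiev's theorem.  A point [y] lies in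
    [W n] when [g], read through [i], maps a neighborhood of [y] into a small
    ball inside [O n]; for [y] in all [W n], the values of [g] near [y] converge
    to a point [i t] of the intersection of the [O n], and [y = i (h t)]. *)
Lemma gdelta_homeo_image (R : realType) (X Y : metricType R) (i : X -> Y)
    (O : nat -> set Y) (h g : X -> X) :
  (forall x y, mdist (i x) (i y) = mdist x y) -> dense (range i) ->
  complete_distance (@mdist R Y) -> (forall n, open (O n)) ->
  \bigcap_n O n `<=` range i ->
  cancel g h -> continuous h -> continuous g ->
  exists W : nat -> set Y, [/\ forall n, open (W n),
    \bigcap_n W n `<=` range i &
    forall x, (\bigcap_n O n) (i (g x)) -> (\bigcap_n W n) (i x)].
Proof.
move=> iso di Yc oO Oi gK hc gc.
pose small n (V : set Y) := exists wr : Y * R, [/\ wr.2 <= n.+1%:R^-1,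
  forall z, mdist wr.1 z <= wr.2 -> O n z &
  forall x, V (i x) -> mdist wr.1 (i (g x)) <= wr.2].
exists (fun n => \bigcup_(V in [set V | open V /\ small n V]) V); split.
- by move=> n; apply: bigcup_open => V [].
- move=> y Wy.
  have /choice[V VP] : forall n, exists V, [/\ open V, small n V & V y].
    by move=> n; have [V [oV sV] Vy] := Wy n I; exists V.
  have /choice[wr wrP] : forall n, exists wr : Y * R, [/\ wr.2 <= n.+1%:R^-1,
      forall z, mdist wr.1 z <= wr.2 -> O n z &
      forall x, V n (i x) -> mdist wr.1 (i (g x)) <= wr.2].
    by move=> n; have [_ sV _] := VP n.
  have /choice[x xP] : forall n, exists x, mdist y (i x) < n.+1%:R^-1 /\
      forall k, (k <= n)%N -> V k (i x).
    move=> n; pose VV := \bigcap_(k < n.+1) V k.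
    have oVV : open VV.
      rewrite /VV bigcap_mkord; elim/big_ind: _ => [|A B|k _].
      + exact: openT.
      + exact: openI.
      + by case: (VP k).
    have [||x [yx VVx]] := @open_meets_range _ _ _ _ di
        ([set z | mdist y z < n.+1%:R^-1] `&` VV) y.
    + by apply: openI => //; exact: open_mdist_lt.
    + split; first by rewrite /= mdistxx invr_gt0 ltr0n.
      by move=> k _; case: (VP k).
    + by exists x; split=> // k kn; apply: VVx.
  have [n|n m nm|z [xz wz]] := @complete_shrinking_balls _ _ (fun n => (wr n).1)
      (fun n => i (g (x n))) (fun n => (wr n).2) Yc.
  + by case: (wrP n).
  + by have [_ _] := wrP n; apply; apply: (xP m).2.
  have [|t _ tz] := Oi z.
    by move=> n _; have [_ + _] := wrP n; apply; exact: wz.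
  exists (h t) => //; apply: mdist_positivity.
  apply/le_anti; rewrite mdist_ge0 andbT.
  apply/ler_addgt0Pr => e e0; rewrite add0r.
  have : nbhs t (h @^-1` [set s | mdist (h t) s < e / 2]).
    by apply: hc; apply/nbhs_mdistP; exists (e / 2) => //; rewrite divr_gt0.
  move=> /nbhs_mdistP[d d0 td]; have [N xN] := xz d d0.
  have [M Me] := invS_lt (divr_gt0 e0 (ltr0n R 2)).
  set n := maxn N M; have := metric_triangle (i (h t)) (i (x n)) y.
  have : mdist (h t) (h (g (x n))) < e / 2.
    by apply: td; rewrite -iso tz metric_sym; exact: xN (leq_maxl _ _).
  rewrite gK -iso (metric_sym (i (x n)) y).
  have := (xP n).1; have := invS_le (R := R) (leq_maxr N M).
  move: Me; rewrite -/n; set v := M.+1%:R^-1; set u := n.+1%:R^-1; lra.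
- move=> x Ox n _.
  have /nbhs_mdistP[e e0 xe] : nbhs (i (g x)) (O n).
    by apply: open_nbhs_nbhs; split; [exact: oO|exact: Ox].
  pose r := Num.min (e / 2) n.+1%:R^-1.
  have r0 : 0 < r by rewrite lt_min divr_gt0//= invr_gt0 ltr0n.
  have : nbhs x (g @^-1` [set s | mdist (g x) s < r]).
    by apply: gc; apply/nbhs_mdistP; exists r.
  move=> /nbhs_mdistP[d d0 xd].
  exists [set z | mdist (i x) z < d]; last by rewrite /= mdistxx.
  split; first exact: open_mdist_lt.
  exists (i (g x), r); split=> /= [|z|s].
  + by rewrite ge_min lexx orbT.
  + rewrite le_min => /andP[gz _]; apply: xe; lra.
  + by rewrite !iso => /xd/ltW.
Qed.

(** * Countable subsets and the G-delta property *)

(** The complement of [range i] has subsets [E k], one of which lies in a member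
    of any countable closed cover of it, and whose closures meet [range i] since
    they are outside the ideal; the [i (q k)] are taken in these closures.  The
    complements of the [W n] form such a cover, so one of them would contain
    some [E k], hence also [i (q k)]. *)
Lemma countable_not_in_gdelta (R : realType) (X Y : metricType R) (i : X -> Y)
    (B : nat -> set Y) :
  complete_distance (@mdist R Y) -> (forall m, open (B m)) ->
  countable_base B -> analytic (~` range i) ->
  ~ sigma_ideal_of (fun C => closed C /\ C `<=` ~` range i) (~` range i) ->
  exists q : nat -> X, forall W : nat -> set Y, (forall n, open (W n)) ->
    \bigcap_n W n `<=` range i -> ~ (forall k, (\bigcap_n W n) (i (q k))).
Proof.
move=> Yc oB Bb Aan notI.
have [//|E EA Ecover] := analytic_notin_sigma_ideal Yc oB Bb _ Aan notI.
  by split; [exact: closed0|].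
have /choice[q qP] : forall k, exists x, closure (E k) (i x).
  move=> k; apply: contrapT => nq; have [_] := EA k; apply.
  apply: sigma_ideal_ofS (@subset_closure _ (E k)) _.
  apply: sigma_ideal_of_gen; split; first exact: closed_closure.
  by move=> y clE [x _ xy]; apply: nq; exists x; rewrite xy.
exists q => W oW Wi qW.
have Wc n : closed (~` W n) by rewrite closedC.
have [|k [n EW]] := Ecover (fun n => ~` W n) Wc.
  by move=> y niy; rewrite -setC_bigcap => /Wi.
by have := Wc n _ (closureS EW (qP k)); apply; exact: qW.
Qed.

Theorem corollary2p4 (R : realType) (X : metricType R)
    (hsep : separable_space X) (hborel : borel_space X)
    (hcdh : countable_dense_homogeneous X) :
  completely_metrizable R X.
Proof.
have [Y [i [[Yc iso di] bA]]] := hborel.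
have [D cD Dd] := hsep.
have [BX oBX BXb] := separable_countable_base cD Dd.
have [BY oBY BYb] := separable_countable_base
  (sub_countable (card_image_le i D) cD) (dense_isometry_image iso di Dd).
have [V oV [F Fcnd OF]] := borel_baire_property bA.
pose G := generic_part V F.
have Gi : G `<=` range i by exact: generic_in_range OF.
have [DY [cDY DYG DYd]] := countable_dense_subset G BYb.
pose D2 := i @^-1` DY.
have iD2 : i @` D2 = DY.
  apply/seteqP; split=> [_ [x Dx <-]//|y Dy].
  by have [x _ xy] := Gi _ (DYG _ Dy); exists x; rewrite // /D2 /= xy.
have cD2 : countable D2 by exact: countable_preimage (isometry_inj iso) cDY.
rewrite -iD2 in DYG DYd.
have U0 := meager_part_empty iso di Yc oV Fcnd OF DYG DYd oBX BXb oBY BYb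
  (borel_analytic bA) cD2 hcdh.
have D2dense (D' : set X) : D2 `<=` D' -> dense D'.
  move=> DD'; apply: (dense_from_meager_part iso Yc oV Fcnd DYd DD').
  by rewrite U0 => W _ + [x Wx] => /(_ x Wx).
have [[C CP iC]|notI] := pselect (sigma_ideal_of
    (fun C => closed C /\ C `<=` ~` range i) (~` range i)).
  apply: (gdelta_completely_metrizable iso Yc (C := C)) => [n|].
    by case: (CP n).
  by apply/seteqP; split=> // y [n _ Cy]; case: (CP n) => _; apply.
have Aan : analytic (~` range i).
  by apply: borel_analytic; rewrite -setTD; exact: sigma_algebraCD.
have [q qP] := countable_not_in_gdelta Yc oBY BYb Aan notI.
have cD' : countable (D2 `|` range q).
  apply: countableU => //.
  by apply: sub_countable (card_image_le _ _) _; exact: countableP.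
have [h [hh hD]] := hcdh.2 D2 (D2 `|` range q) cD2
  (D2dense _ (@subset_refl _ _)) cD' (D2dense _ (@subsetUl _ _ _)).
have [g [_ hK gK hc gc]] := homeomorphism_inv hh.
have GE : G = \bigcap_n (V `&` ~` F n).
  apply/seteqP; split=> [y [Vy nFy] n _|y Gy].
    by split=> // Fy; apply: nFy; exists n.
  by split=> [|[n _ Fy]]; [case: (Gy 0%N I)|case: (Gy n I)].
have [n||W [oW Wi GW]] := gdelta_homeo_image (O := fun n => V `&` ~` F n)
    iso di Yc _ _ gK hc gc.
- by apply: openI => //; rewrite openC; case: (Fcnd n).
- by rewrite -GE.
case: (qP W oW Wi) => k; apply: GW; rewrite -GE.
have : (h @` D2) (q k) by rewrite hD; right; exists k.
by move=> [x Dx <-]; rewrite hK; apply: DYG; exists x.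
Qed.
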